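(* Let $M$ be a left $R$-module which is projective in $\sigma[M]$. Consider the conditions: (a) $\Lambda^{fi}(M)$ is normal; (b) $M$ is strongly harmonic. Then (a) implies (b). If in addition $\Lambda^{fi}(M)$ is compact, then (a) and (b) are equivalent.
   Context: $R$ is an associative ring with identity; modules are unital left $R$-modules. A submodule $N\leq M$ is fully invariant if $f(N)\subseteq N$ for all $f\in\mathrm{End}_R(M)$; $\Lambda^{fi}(M)$ is the complete lattice of fully invariant submodules of $M$ ordered by inclusion, and $Max^{fi}(M)$ is the set of its coatoms (maximal proper elements). $\sigma[M]$ is the full subcategory of $R$-Mod of all modules that embed in a quotient of some direct sum $M^{(X)}$. $M$ is $N$-projective if for every epimorphism $\rho\colon N\to X$ and every homomorphism $\alpha\colon M\to X$ there is $\beta\colon M\to N$ with $\rho\beta=\alpha$; $M$ is projective in $\sigma[M]$ if it is $N$-projective for every $N\in\sigma[M]$. For $N,L\leq M$ put $N_ML=\sum\{f(N)\mid f\in\mathrm{Hom}_R(M,L)\}$. $M$ is strongly harmonic if for every two distinct $N,L\in Max^{fi}(M)$ there exist $N',L'\in\Lambda^{fi}(M)$ with $L'\nleq L$, $N'\nleq N$ and $L'_MN'=0$. $\Lambda^{fi}(M)$ is normal if for all $A,B\in\Lambda^{fi}(M)$ with $A+B=M$ there exist $A',B'\in\Lambda^{fi}(M)$ with $A+B'=M=A'+B$ and $A'_MB'=0$. $\Lambda^{fi}(M)$ is compact if whenever $M=\sum_{i\in I}N_i$ with all $N_i\in\Lambda^{fi}(M)$, there is a finite $F\subseteq I$ with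 $M=\sum_{i\in F}N_i$. *)

(* Defs.v *)
From HB Require Import structures.
From mathcomp Require Import all_boot all_algebra.
From mathcomp Require Import boolp classical_sets functions cardinality.

Set Implicit Arguments.
Unset Strict Implicit.
Unset Printing Implicit Defensive.

Import GRing.Theory.
Local Open Scope classical_set_scope.
Local Open Scope ring_scope.

Section DirectSum.
Variables (R : pzRingType) (X : Type) (M : lmodType R).

Definition finsupp_fun : {pred X -> M} :=
  fun f => `[< finite_set [set i | f i <> 0] >].

Lemma finsupp_fun_submod_closed : submod_closed finsupp_fun.
Proof.
split=> [|a f g /asboolP finf /asboolP fing]; apply/asboolP.
  by rewrite (_ : mkset _ = set0)//; apply/seteqP; split=> i //= [].
apply: (@sub_finite_set _ _ ([set i | f i <> 0] `|` [set i | g i <> 0])).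
  move=> i /= fgi; apply: contrapT => /not_orP[/contrapT fi0 /contrapT gi0].
  by apply: fgi; rewrite /GRing.add/= /GRing.scale/= fi0 gi0 scaler0 addr0.
by rewrite finite_setU.
Qed.

HB.instance Definition _ :=
  GRing.isSubmodClosed.Build R (X -> M) finsupp_fun finsupp_fun_submod_closed.

(* The direct sum M^(X), as the finitely supported functions X -> M. *)
Record direct_sum : Type := DirectSum {
  direct_sum_fun :> X -> M;
  _ : direct_sum_fun \in finsupp_fun }.

HB.instance Definition _ := [isSub for direct_sum_fun].
HB.instance Definition _ := [Choice of direct_sum by <:].
HB.instance Definition _ := [SubChoice_isSubLmodule of direct_sum by <:].

End DirectSum.

(* N belongs to sigma[M]: Q ranges, up to isomorphism, over the quotients of
   the direct sums M^(X), and N embeds in Q. *)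
Definition in_sigma (R : pzRingType) (M N : lmodType R) : Prop :=
  exists (X : Type) (Q : lmodType R)
         (p : {linear direct_sum X M -> Q}) (i : {linear N -> Q}),
    range p = setT /\ injective i.

Definition projective_wrt (R : pzRingType) (M N : lmodType R) : Prop :=
  forall (X : lmodType R) (rho : {linear N -> X}) (alpha : {linear M -> X}),
    range rho = setT ->
    exists beta : {linear M -> N}, rho \o beta = alpha.

(* P is projective in sigma[M]. *)
Definition projective_in_sigma (R : pzRingType) (M P : lmodType R) : Prop :=
  forall N : lmodType R, in_sigma M N -> projective_wrt P N.

Section FullyInvariant.
Variables (R : pzRingType) (M : lmodType R).
Implicit Types (N L A B K : set M).

Definition submodule N : Prop := submod_closed (mem N).

Definition fully_invariant N : Prop :=
  submodule N /\ forall f : {linear M -> M}, f @` N `<=` N.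

Definition max_fully_invariant N : Prop :=
  [/\ fully_invariant N, N <> setT &
      forall K, fully_invariant K -> N `<=` K -> K = N \/ K = setT].

(* Sum of a collection of submodules: the finite sums of elements taken from
   the members (repetitions allowed; the empty sum is 0). *)
Definition submodule_sum (C : set (set M)) : set M :=
  [set x | exists (n : nat) (y : 'I_n -> M),
     (forall k, exists2 N, C N & N (y k)) /\ x = \sum_(k < n) y k].

Definition submodule_add A B : set M := [set a + b | a in A & b in B].

(* N_M L: a homomorphism M -> L is an endomorphism of M with values in L. *)
Definition submodule_prod N L : set M :=
  submodule_sum
    [set K | exists2 f : {linear M -> M}, range f `<=` L & K = f @` N].

Definition strongly_harmonic : Prop :=
  forall N L, max_fully_invariant N -> max_fully_invariant L -> N <> L ->
  exists N' L', [/\ fully_invariant N', fully_invariant L',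
    ~ (L' `<=` L), ~ (N' `<=` N) & submodule_prod L' N' = [set 0]].

Definition normal_fi_lattice : Prop :=
  forall A B, fully_invariant A -> fully_invariant B ->
  submodule_add A B = setT ->
  exists A' B', [/\ fully_invariant A', fully_invariant B',
    submodule_add A B' = setT, submodule_add A' B = setT &
    submodule_prod A' B' = [set 0]].

Definition compact_fi_lattice : Prop :=
  forall (I : Type) (N : I -> set M), (forall i, fully_invariant (N i)) ->
  submodule_sum (range N) = setT ->
  exists2 F : set I, finite_set F & submodule_sum (N @` F) = setT.

End FullyInvariant.

Arguments strongly_harmonic {R} M.
Arguments normal_fi_lattice {R} M.
Arguments compact_fi_lattice {R} M.

(* Main.v *)
From HB Require Import structures.
From mathcomp Require Import all_boot all_algebra.
From mathcomp Require Import boolp classical_sets functions cardinality.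
Require Import Defs.

(** Everything projectivity contributes is one splitting property
    ([linear_split]): if an endomorphism f of M has its values in A + B, then
    f = f1 + f2 with f1 taking values in A and f2 in B.  It comes from lifting
    f along the sum map from the external sum of A and B, a submodule of
    M^(2), onto A + B.  Two facts follow.

    - X_M Y1 = X_M Y2 = 0 implies X_M (Y1 + Y2) = 0
      ([submodule_prod_eq0_addr]); additivity in the first factor is free.
    - If B + X = B + Y = M with all three fully invariant, then B + (X /\ Y) = M
      ([comaximal_cap]): the identity of M splits through B and Y, and the
      Y-component of an element of X stays in X by full invariance.  In
      particular, two fully invariant submodules that are not below a coatom P
      have an intersection that is not below P either; call this primeness.

    Normal implies strongly harmonic because two distinct coatoms N and L
    satisfy N + L = M; normality applied to this pair gives submodules that
    escape N and L and have zero product.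

    For the converse, compactness is used in the following form
    ([compact_comaximal]): if a nonempty collection S of fully invariant
    submodules is closed under binary sums and no coatom above A contains all
    of S, then A + Y = M for a single Y in S. Let A + B = M. Normality for (A,
    B) asks for such a Y in the collection S of those Y with X_M Y = 0 for some
    X with B + X = M, and S is closed under sums by the two facts above. It
    remains to see that S escapes each coatom P above A. For that, fix P and
    let T be the collection of those X with X_M Y = 0 for some Y not below P; T
    is closed under sums by primeness of P. A coatom Q above B differs from P,
    since A + B = M, so strong harmonicity puts in T a submodule that is not
    below Q. Hence the same compactness statement, now for B and T, gives X in
    T with B + X = M, and the Y that witnesses X in T belongs to S and is not
    below P. *)

Set Implicit Arguments.
Unset Strict Implicit.
Unset Printing Implicit Defensive.

Import GRing.Theory.
Local Open Scope classical_set_scope.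
Local Open Scope ring_scope.

(** * Submodules as modules *)

Section SubmoduleType.
Variables (R : pzRingType) (V : lmodType R) (N : set V).

(** The proof hN is an argument, so that a canonical closure instance can be
    attached to an arbitrary set N. *)
Definition submodule_pred (hN : submodule N) : {pred V} := mem N.

HB.instance Definition _ (hN : submodule N) :=
  GRing.isSubmodClosed.Build R V (submodule_pred hN)
    (hN : submod_closed (submodule_pred hN)).

Record submodule_type (hN : submodule N) : Type := SubmoduleType {
  submodule_val :> V;
  _ : submodule_val \in submodule_pred hN }.

HB.instance Definition _ hN := [isSub for @submodule_val hN].
HB.instance Definition _ hN := [Choice of submodule_type hN by <:].
HB.instance Definition _ hN :=
  [SubChoice_isSubLmodule of submodule_type hN by <:].

Lemma submodule0 : submodule N -> N 0.
Proof. by move=> [/set_mem]. Qed.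

Lemma submodule_lin : submodule N ->
  forall (a : R) x y, N x -> N y -> N (a *: x + y).
Proof. by move=> [_ h] a x y /mem_set Nx /mem_set Ny; exact/set_mem/h. Qed.

Lemma submoduleD : submodule N -> forall x y, N x -> N y -> N (x + y).
Proof. by move=> h x y Nx Ny; rewrite -(scale1r x); exact: submodule_lin. Qed.

Lemma submoduleP : N 0 -> (forall (a : R) x y, N x -> N y -> N (a *: x + y)) ->
  submodule N.
Proof.
by move=> N0 Nl; split=> [|a x y /set_mem ? /set_mem ?]; apply/mem_set => //;
  exact: Nl.
Qed.

Lemma corestriction (hN : submodule N) (U : lmodType R) (f : {linear U -> V}) :
  range f `<=` N ->
  exists g : {linear U -> submodule_type hN}, forall x, val (g x) = f x.
Proof.
move=> fN; have fP x : f x \in submodule_pred hN by apply/mem_set/fN; exists x.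
pose g x : submodule_type hN := SubmoduleType (fP x).
have g_lin : linear g by move=> a x y; apply/val_inj; rewrite /= linearP.
by exists (HB.pack_for {linear U -> submodule_type hN} g
  (GRing.isLinear.Build _ _ _ _ _ g_lin)).
Qed.

End SubmoduleType.

Section DirectSumCoord.
Variables (R : pzRingType) (X : Type) (M : lmodType R) (i : X).

Definition direct_sum_coord (g : direct_sum X M) : M := g i.

Lemma direct_sum_coord_linear : linear direct_sum_coord.
Proof. by []. Qed.

HB.instance Definition _ :=
  GRing.isLinear.Build _ _ _ _ direct_sum_coord direct_sum_coord_linear.

End DirectSumCoord.

Section FullyInvariantLattice.
Variables (R : pzRingType) (M : lmodType R).
Implicit Types (A B K L N P Q X Y : set M) (f : {linear M -> M}).

(** * Sums and intersections of fully invariant submodules *)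

Lemma submodule_addS A B : submodule A -> submodule B ->
  submodule (submodule_add A B).
Proof.
move=> sA sB; apply: submoduleP => [|a x y].
  by exists 0; [exact: submodule0|exists 0; [exact: submodule0|rewrite addr0]].
move=> [u Au [v Bv <-]] [u' Au' [v' Bv' <-]].
exists (a *: u + u'); first exact: submodule_lin.
exists (a *: v + v'); first exact: submodule_lin.
by rewrite scalerDr addrACA.
Qed.

Lemma fi_add A B : fully_invariant A -> fully_invariant B ->
  fully_invariant (submodule_add A B).
Proof.
move=> [sA fA] [sB fB]; split=> [|f _ [_ [a Aa [b Bb <-]] <-]].
  exact: submodule_addS.
rewrite linearD; exists (f a); first by apply: fA; exists a.
by exists (f b) => //; apply: fB; exists b.
Qed.

Lemma fi_cap A B : fully_invariant A -> fully_invariant B ->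
  fully_invariant (A `&` B).
Proof.
move=> [sA fA] [sB fB]; split=> [|f _ [x [Ax Bx] <-]].
  apply: submoduleP; first by split; exact: submodule0.
  by move=> a x y [? ?] [? ?]; split; exact: submodule_lin.
by split; [apply: fA|apply: fB]; exists x.
Qed.

Lemma fi_zero : fully_invariant [set 0 : M].
Proof.
split=> [|f _ [_ -> <-]]; last exact: linear0.
by apply: submoduleP => // a x y -> ->; rewrite scaler0 addr0.
Qed.

Lemma fi_top : fully_invariant [set: M].
Proof. by split=> //; exact: submoduleP. Qed.

Lemma submodule_addl A B : submodule B -> A `<=` submodule_add A B.
Proof.
by move=> sB a Aa; exists a => //; exists 0; [exact: submodule0|rewrite addr0].
Qed.

Lemma submodule_addr A B : submodule A -> B `<=` submodule_add A B.
Proof.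
by move=> sA b Bb; exists 0; [exact: submodule0|exists b => //; rewrite add0r].
Qed.

Lemma submodule_addC A B : submodule_add A B = submodule_add B A.
Proof.
by apply/seteqP; split=> _ [x ? [y ? <-]]; rewrite addrC; exists y => //;
  exists x.
Qed.

Lemma submodule_add_sub A B P : submodule P -> A `<=` P -> B `<=` P ->
  submodule_add A B `<=` P.
Proof.
by move=> sP AP BP _ [a /AP Pa [b /BP Pb <-]]; exact: submoduleD.
Qed.

(** * Splitting endomorphisms by projectivity *)

(** The external sum of A and B is realized as the submodule N of M^(2) cut out
    by the two coordinates.  It lies in sigma[M] and maps onto A + B, so f lifts
    to it; the coordinates of the lift are the two summands. *)
Lemma linear_split A B f : projective_in_sigma M M ->
  submodule A -> submodule B -> range f `<=` submodule_add A B ->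
  exists f1 f2 : {linear M -> M},
    [/\ range f1 `<=` A, range f2 `<=` B & forall x, f x = f1 x + f2 x].
Proof.
move=> hM sA sB fAB.
have sAB := submodule_addS sA sB.
pose D := direct_sum bool M.
pose N : set D := [set g | A (g true) /\ B (g false)].
have sN : submodule N.
  apply: submoduleP; first by split; exact: submodule0.
  by move=> a x y [? ?] [? ?]; split; exact: submodule_lin.
pose total : {linear submodule_type sN -> M} :=
  (direct_sum_coord true \+ direct_sum_coord false) \o \val.
have totalAB : range total `<=` submodule_add A B.
  move=> _ [g _ <-]; have [? ?] := set_mem (valP g).
  by exists (val g true) => //; exists (val g false).
have [rho rhoE] := corestriction sAB totalAB.
have [alpha alphaE] := corestriction sAB fAB.
have sigN : in_sigma M (submodule_type sN).
  exists bool, D, idfun, \val; split; last exact: val_inj.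
  by apply/seteqP; split=> // g _; exists g.
have rho_epi : range rho = setT.
  apply/seteqP; split=> // z _; have [a Aa [b Bb abz]] := set_mem (valP z).
  have fin : (fun i : bool => if i then a else b) \in @finsupp_fun R bool M.
    by apply/asboolP.
  have gN : DirectSum fin \in submodule_pred sN by apply/mem_set.
  by exists (SubmoduleType gN) => //; apply/val_inj; rewrite rhoE.
have [beta betaE] := hM _ sigN _ rho alpha rho_epi.
exists (direct_sum_coord true \o (\val \o beta)).
exists (direct_sum_coord false \o (\val \o beta)).
split=> [_ [x _ <-]|_ [x _ <-]|x]; try by have [] := set_mem (valP (beta x)).
by rewrite -alphaE -betaE /= rhoE.
Qed.

(** The lattice of fully invariant submodules need not be distributive.  What
    replaces distributivity here is a splitting id = f1 + f2 through B + Y: for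
    m = b + x with x in X, one has m = (b + f1 x) + f2 x, and f2 x lies in Y by
    construction and in X by full invariance. *)
Lemma comaximal_cap B X Y : projective_in_sigma M M ->
  fully_invariant B -> fully_invariant X -> fully_invariant Y ->
  submodule_add B X = setT -> submodule_add B Y = setT ->
  submodule_add B (X `&` Y) = setT.
Proof.
move=> hM [sB fB] [sX fX] [sY fY] BX BY; apply/seteqP; split=> // m _.
have idBY : range (idfun : {linear M -> M}) `<=` submodule_add B Y by rewrite BY.
have [f1 [f2 [f1B f2Y fE]]] := linear_split hM sB sY idBY.
have : submodule_add B X m by rewrite BX.
move=> [b Bb [x Xx <-]]; exists (b + f1 x).
  by apply: submoduleD => //; apply: f1B; exists x.
exists (f2 x); last by rewrite -addrA -fE.
by split; [apply: fX|apply: f2Y]; exists x.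
Qed.

(** * Vanishing of the product N_M L *)

Lemma submodule_prod_eq0 K L :
  submodule_prod K L = [set 0] <->
  forall f, range f `<=` L -> forall x, K x -> f x = 0.
Proof.
split=> [KL0 f fL x Kx|KL0].
  suff : submodule_prod K L (f x) by rewrite KL0.
  exists 1%N, (fun=> f x); split; last by rewrite big_ord1.
  by move=> _; exists (f @` K); [exists f|exists x].
apply/seteqP; split=> [_ [n [y [yKL ->]]]|_ ->].
  apply: big1 => k _; have [_ [f fL ->] [x Kx <-]] := yKL k.
  exact: KL0.
by exists 0%N, (fun=> 0); split=> [[]//|]; rewrite big_ord0.
Qed.

Lemma submodule_prod_eq0_addl X1 X2 Y :
  submodule_prod X1 Y = [set 0] -> submodule_prod X2 Y = [set 0] ->
  submodule_prod (submodule_add X1 X2) Y = [set 0].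
Proof.
move=> /submodule_prod_eq0 X1Y /submodule_prod_eq0 X2Y.
apply/submodule_prod_eq0 => f fY _ [x1 ? [x2 ? <-]].
by rewrite linearD X1Y // X2Y // addr0.
Qed.

(** In the second factor additivity depends on projectivity: an endomorphism
    with values in Y1 + Y2 has to be split before the hypotheses apply. *)
Lemma submodule_prod_eq0_addr X Y1 Y2 : projective_in_sigma M M ->
  submodule Y1 -> submodule Y2 ->
  submodule_prod X Y1 = [set 0] -> submodule_prod X Y2 = [set 0] ->
  submodule_prod X (submodule_add Y1 Y2) = [set 0].
Proof.
move=> hM sY1 sY2 /submodule_prod_eq0 XY1 /submodule_prod_eq0 XY2.
apply/submodule_prod_eq0 => f fY x Xx.
have [f1 [f2 [f1Y f2Y ->]]] := linear_split hM sY1 sY2 fY.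
by rewrite XY1 // XY2 // addr0.
Qed.

Lemma submodule_prod_eq0_sub X X' Y Y' : X' `<=` X -> Y' `<=` Y ->
  submodule_prod X Y = [set 0] -> submodule_prod X' Y' = [set 0].
Proof.
move=> X'X Y'Y /submodule_prod_eq0 XY.
apply/submodule_prod_eq0 => f fY' x X'x.
by apply: XY (X'X _ X'x); exact: subset_trans fY' Y'Y.
Qed.

(** * Compactness and coatoms *)

(** Escaping a coatom P is comaximality with P; this is the form in which
    [comaximal_cap] applies to P and gives its primeness. *)
Lemma max_fi_comaximal P Y : max_fully_invariant P -> fully_invariant Y ->
  submodule_add P Y = setT <-> ~ Y `<=` P.
Proof.
move=> [fiP PT Pmax] fiY; split=> [PY YP|YP].
  apply: PT; apply/seteqP; split=> // x _.
  have : submodule_add P Y x by rewrite PY.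
  by apply: submodule_add_sub; first exact: fiP.1.
have [PYP|//] := Pmax _ (fi_add fiP fiY) (submodule_addl (A := P) fiY.1).
by case: YP; rewrite -PYP; exact/submodule_addr/fiP.1.
Qed.

Definition directed (C : set (set M)) : Prop :=
  C !=set0 /\
  forall X Y, C X -> C Y -> exists Z, [/\ C Z, X `<=` Z & Y `<=` Z].

Lemma fi_directed_bigcup (C : set (set M)) : directed C ->
  C `<=` @fully_invariant R M -> fully_invariant (\bigcup_(X in C) X).
Proof.
move=> [[X0 CX0] dirC] fiC; split=> [|f _ [x [X CX Xx] <-]].
  apply: submoduleP => [|a x y [X CX Xx] [Y CY Yy]].
    by exists X0 => //; exact: submodule0 (fiC _ CX0).1.
  have [Z [CZ XZ YZ]] := dirC _ _ CX CY; exists Z => //.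
  by apply: submodule_lin; [exact: (fiC _ CZ).1|exact: XZ|exact: YZ].
by exists X => //; apply: (fiC _ CX).2; exists x.
Qed.

Lemma directed_seq_ub (C : set (set M)) (s : seq (set M)) : directed C ->
  {in s, forall X, C X} -> exists2 Z, C Z & {in s, forall X, X `<=` Z}.
Proof.
move=> [[X0 CX0] dirC]; elim: s => [_|X s IHs Cs]; first by exists X0.
have [Y sY|Z CZ sZ] := IHs; first by apply: Cs; rewrite in_cons sY orbT.
have [W [CW XW ZW]] := dirC X Z (Cs X (mem_head X s)) CZ.
exists W => // Y; rewrite in_cons => /orP[/eqP -> //|/sZ YZ].
exact: subset_trans ZW.
Qed.

(** Compactness extracts a finite subfamily with sum M; a member of C above
    that subfamily contains its sum, hence is M. *)
Lemma compact_directed (C : set (set M)) : compact_fi_lattice M ->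
  C `<=` @fully_invariant R M -> directed C -> \bigcup_(X in C) X = setT ->
  C setT.
Proof.
move=> cptM fiC dirC CT.
have [//||F finF FT] := @cptM {X | C X} (@sval _ _).
- by move=> [X CX]; exact: fiC.
- apply/seteqP; split=> // x _.
  have : (\bigcup_(X in C) X) x by rewrite CT.
  move=> [X CX Xx]; exists 1%N, (fun=> x); split; last by rewrite big_ord1.
  by move=> _; exists X => //; exists (exist _ X CX).
have /finite_seqP[s Fs] : finite_set (sval @` F) by exact: finite_image.
have [X sX|Z CZ sZ] := directed_seq_ub (s := s) dirC.
  have : [set` s] X by [].
  by rewrite -Fs => -[[Y CY] _ <-].
suff <- : Z = setT by [].
apply/seteqP; split=> // x _.
have [n [y [yF ->]]] : submodule_sum (sval @` F) x by rewrite FT.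
have sumZ : \sum_(k < n) y k \in submodule_pred (fiC _ CZ).1.
  apply: rpred_sum => k _; apply/mem_set.
  have [X + Xy] := yF k; rewrite Fs /= => /sZ; exact.
exact: set_mem sumZ.
Qed.

(** Zorn's lemma: by compactness, the union of a chain of proper fully invariant
    submodules is proper. *)
Lemma exists_max_fi K : compact_fi_lattice M ->
  fully_invariant K -> K <> setT ->
  exists2 P, max_fully_invariant P & K `<=` P.
Proof.
move=> cptM fiK KT.
(* Zorn is run on sets X through the union of K and X, so that the empty chain
   has the upper bound K. *)
pose proper X := fully_invariant (K `|` X) /\ K `|` X <> setT.
have chain F : F `<=` proper -> total_on F subset ->
    proper (\bigcup_(X in F) X).
  move=> Fproper Ftot.
  pose C := [set K] `|` [set K `|` X | X in F].
  have CE : K `|` \bigcup_(X in F) X = \bigcup_(Z in C) Z.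
    apply/seteqP; split=> [x [Kx|[X FX Xx]]|x [_ [->|[X FX <-]]]].
    - by exists K => //; left.
    - by exists (K `|` X); [right; exists X|right].
    - by left.
    - by case=> ?; [left|right; exists X].
  have fiC : C `<=` @fully_invariant R M.
    by move=> _ [->//|[X /Fproper[fiX _] <-]].
  have dirC : directed C.
    split=> [|_ _ [->|[X FX <-]] [->|[Y FY <-]]]; first by exists K; left.
    - by exists K; split=> //; left.
    - by exists (K `|` Y); split=> //; right; exists Y.
    - by exists (K `|` X); split=> //; right; exists X.
    have [XY|YX] := Ftot _ _ FX FY.
      exists (K `|` Y); split=> //; first by right; exists Y.
      exact: setUS.
    exists (K `|` X); split=> //; first by right; exists X.
    exact: setUS.
  rewrite /proper CE; split; first exact: fi_directed_bigcup.
  move=> /(compact_directed cptM fiC dirC)[/esym//|[X /Fproper[_ +] XT]].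
  by rewrite XT.
have [X [[fiX XT] Xmax]] := Zorn_bigcup chain.
exists (K `|` X); last exact: subsetUl.
split=> // L fiL XL; have [->|LT] := pselect (L = setT); first by right.
left; apply: contrapT => LX; apply: (Xmax L).
  split=> [|LX']; first by apply: subset_trans XL; exact: subsetUr.
  by apply: LX; apply/seteqP; split=> //; apply: subset_trans LX' _;
    exact: subsetUr.
by rewrite /proper setUidr //; apply: subset_trans XL; exact: subsetUl.
Qed.

(** The submodules A + Y with Y in S form a directed family.  Its union is fully
    invariant and contained in no coatom, hence is M, so compactness makes one
    of its members equal to M. *)
Lemma compact_comaximal A (S : set (set M)) : compact_fi_lattice M ->
  fully_invariant A -> S `<=` @fully_invariant R M -> S !=set0 ->
  (forall X Y, S X -> S Y -> S (submodule_add X Y)) ->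
  (forall P, max_fully_invariant P -> A `<=` P ->
     exists2 Y, S Y & ~ Y `<=` P) ->
  exists2 Y, S Y & submodule_add A Y = setT.
Proof.
move=> cptM fiA fiS [Y0 SY0] addS escape.
pose C := [set submodule_add A Y | Y in S].
have fiC : C `<=` @fully_invariant R M.
  by move=> _ [Y SY <-]; exact/fi_add/fiS.
have dirC : directed C.
  split=> [|_ _ [X SX <-] [Y SY <-]]; first by exists (submodule_add A Y0), Y0.
  have [[sX _] [sY _]] := (fiS _ SX, fiS _ SY).
  exists (submodule_add A (submodule_add X Y)); split.
  - by exists (submodule_add X Y) => //; exact: addS.
  - move=> _ [a Aa [x Xx <-]]; exists a => //; exists x => //.
    exact: submodule_addl.
  - move=> _ [a Aa [y Yy <-]]; exists a => //; exists y => //.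
    exact: submodule_addr.
suff : \bigcup_(Z in C) Z = setT.
  by move=> /(compact_directed cptM fiC dirC)[Y SY YT]; exists Y.
apply: contrapT => CT.
have [P Pmax CP] := exists_max_fi cptM (fi_directed_bigcup dirC fiC) CT.
have subP Y : S Y -> submodule_add A Y `<=` P.
  by move=> SY x AYx; apply: CP; exists (submodule_add A Y) => //; exists Y.
have [|Y SY] := escape P Pmax.
  apply: subset_trans (subP _ SY0); exact: submodule_addl (fiS _ SY0).1.
by apply; apply: subset_trans (subP _ SY); exact: submodule_addr fiA.1.
Qed.

(** * Normality and strong harmonicity *)

Lemma normal_strongly_harmonic : normal_fi_lattice M -> strongly_harmonic M.
Proof.
move=> normM N L Nmax Lmax NL; have [[fiN NT _] [fiL LT Lm]] := (Nmax, Lmax).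
have NLT : submodule_add N L = setT.
  apply/(max_fi_comaximal Nmax fiL) => LN.
  by have [|] := Lm N fiN LN.
have [A' [B' [fiA' fiB' NB' A'L A'B']]] := normM N L fiN fiL NLT.
exists B', A'; split=> //.
  by apply/(max_fi_comaximal Lmax fiA'); rewrite submodule_addC.
exact/(max_fi_comaximal Nmax fiB').
Qed.

(** Two nested uses of [compact_comaximal]: the outer one looks for the factor
    B' of the normality condition, the inner one shows for a given coatom above
    A that some candidate for B' is not contained in it. *)
Lemma strongly_harmonic_normal : projective_in_sigma M M ->
  compact_fi_lattice M -> strongly_harmonic M -> normal_fi_lattice M.
Proof.
move=> hM cptM shM A B fiA fiB ABT.
pose S := [set Y | fully_invariant Y /\ exists X, [/\ fully_invariant X,
  submodule_add B X = setT & submodule_prod X Y = [set 0]]].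
suff [B' [fiB' [A' [fiA' BA' A'B']]] AB'] :
    exists2 Y, S Y & submodule_add A Y = setT.
  by exists A', B'; split=> //; rewrite submodule_addC.
apply: compact_comaximal => //.
- by move=> Y [].
- exists [set 0]; split; first exact: fi_zero.
  exists setT; split.
  + exact: fi_top.
  + by apply/seteqP; split=> // x _; apply: submodule_addr fiB.1 _ _.
  + by apply/submodule_prod_eq0 => f f0 x _; apply: f0; exists x.
- move=> Y1 Y2 [fiY1 [X1 [fiX1 BX1 XY1]]] [fiY2 [X2 [fiX2 BX2 XY2]]].
  split; first exact: fi_add.
  have fiX := fi_cap fiX1 fiX2.
  exists (X1 `&` X2); split=> //; first exact: comaximal_cap.
  apply: submodule_prod_eq0_addr fiY1.1 fiY2.1 _ _ => //.
  + exact: submodule_prod_eq0_sub XY1.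
  + exact: submodule_prod_eq0_sub XY2.
move=> P Pmax AP; have [fiP PT _] := Pmax.
pose T := [set X | fully_invariant X /\ exists Y, [/\ fully_invariant Y,
  ~ Y `<=` P & submodule_prod X Y = [set 0]]].
suff [X [fiX [Y [fiY YP XY]]] BX] : exists2 X, T X & submodule_add B X = setT.
  by exists Y => //; split=> //; exists X.
apply: compact_comaximal => //.
- by move=> X [].
- exists [set 0]; split; first exact: fi_zero.
  exists setT; split.
  + exact: fi_top.
  + by move=> TP; apply: PT; apply/seteqP; split.
  + by apply/submodule_prod_eq0 => f _ x ->; exact: linear0.
- move=> X1 X2 [fiX1 [Y1 [fiY1 PY1 XY1]]] [fiX2 [Y2 [fiY2 PY2 XY2]]].
  split; first exact: fi_add.
  have fiY := fi_cap fiY1 fiY2.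
  exists (Y1 `&` Y2); split=> //.
    apply/(max_fi_comaximal Pmax fiY); apply: comaximal_cap => //.
    + exact/max_fi_comaximal.
    + exact/max_fi_comaximal.
  apply: submodule_prod_eq0_addl.
  + exact: submodule_prod_eq0_sub XY1.
  + exact: submodule_prod_eq0_sub XY2.
move=> Q Qmax BQ.
have PQ : P <> Q.
  move=> PQ; apply: PT; apply/seteqP; split=> //; rewrite -ABT.
  by apply: submodule_add_sub fiP.1 AP _; rewrite PQ.
have [N' [L' [fiN' fiL' LQ NP LN]]] := shM P Q Pmax Qmax PQ.
by exists L' => //; split=> //; exists N'.
Qed.

End FullyInvariantLattice.

Theorem proposition4p16 (R : pzRingType) (M : lmodType R)
    (hM : projective_in_sigma M M) :
  (normal_fi_lattice M -> strongly_harmonic M) /\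
  (compact_fi_lattice M -> (normal_fi_lattice M <-> strongly_harmonic M)).
Proof.
split=> [|cptM]; first exact: normal_strongly_harmonic.
by split; [exact: normal_strongly_harmonic|exact: strongly_harmonic_normal].
Qed.
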